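(* Let $(\boldsymbol{x}^{pt*},\boldsymbol{s}^* )$ (together with the associated binary and auxiliary variables) be a global optimal solution of the relaxed mixed-integer convex program (MICP) defined in the context. Let $\boldsymbol{x}^L(\boldsymbol{s}^* )$ be the unique logit flow for the frequency vector $\boldsymbol{s}^*$, and let $\Omega_{cap}(\boldsymbol{s}^* )$ be the polytope of flows satisfying the capacity constraint for $\boldsymbol{s}^*$ (both defined in the context). Then $(\boldsymbol{x}^{pt*},\boldsymbol{s}^* )$ is exact and globally optimal for the original non-convex PT best-response problem (i.e. it is feasible and globally optimal for that problem) if and only if $\boldsymbol{x}^L(\boldsymbol{s}^* )\in\Omega_{cap}(\boldsymbol{s}^* )$.
   Context: Data. $\tilde D$ is a finite set of origin-destination pairs with demands $\alpha_{od}>0$; $L$ is a finite set of transit lines; $\mathcal E^{pt}$ is a finite set of transit edges; $S\subset\mathbb R_{>0}$ is a finite set of admissible frequencies; $\Gamma_{od}\subseteq L$ is the set of lines used by the reference transit path of $(o,d)$; $\eta_e^{od},\mu_e^l\in\{0,1\}$ indicate whether transit edge $e$ lies on the reference path of $(o,d)$, respectively on line $l$. Constants: $C_l>0$ (capacity), $K_l$ (operating cost), $\mathrm{VOT}>0$, transit fare $P^{pt}$ and social benefit parameter $\omega$ with $P^{pt}+\omega>0$, fixed transit times $\tau_{od}^{pt}$, $C_{od}:=\mathrm{VOT}\cdot\tau_{od}^{pt}+P^{pt}$, and fixed AMoD utilities $V_{od}^a\in\mathbb R$. Frequency selection (S): $z_{ls}\in\{0,1\}$, $\sum_{s\in S}z_{ls}=1$,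 $s_l=\sum_{s\in S}s\,z_{ls}$ for all $l\in L$. Capacity (K): $\sum_{(o,d)\in\tilde D}\eta_e^{od}x_{od}^{pt}\le\sum_{l\in L}C_l\mu_e^ls_l$ for all $e\in\mathcal E^{pt}$. For given $\boldsymbol{s}$, $\Omega_{cap}(\boldsymbol{s})$ is the set of $\boldsymbol{x}^{pt}=(x_{od}^{pt})$ with $0\le x_{od}^{pt}\le\alpha_{od}$ satisfying (K). Expected waiting time: $W_{od}(\boldsymbol{s})=\sum_{l\in\Gamma_{od}}\frac{1}{2s_l}$. Logit flow: $\boldsymbol{x}^L(\boldsymbol{s})$ is the vector whose component $x_{od}^L(\boldsymbol{s})$ is the unique $x\in(0,\alpha_{od})$ with $\ln\frac{x}{\alpha_{od}-x}=-\mathrm{VOT}\cdot W_{od}(\boldsymbol{s})-C_{od}-V_{od}^a$. Equivalently, it is the unique positive solution of $x\ln x-x\ln(\alpha_{od}-x)+\mathrm{VOT}\,x\,W_{od}(\boldsymbol{s})+x(C_{od}+V_{od}^a)=0$. Objective (to be maximized): $F(\boldsymbol{x}^{pt},\boldsymbol{s})=\sum_{(o,d)\in\tilde D}(P^{pt}+\omega)x_{od}^{pt}-\sum_{l\in L}K_ls_l$. Original PT best-response problem: maximize $F$ over $(\boldsymbol{x}^{pt},\boldsymbol{s},\boldsymbol{z})$ subject to (S), (K) and the logit choice equality $\boldsymbol{x}^{pt}=\boldsymbol{x}^L(\boldsymbol{s})$. Relaxed MICP: maximize $F$ over $(\boldsymbol{x}^{pt},\boldsymbol{s},\boldsymbol{z},\boldsymbol{u})$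 with $0\le x_{od}^{pt}<\alpha_{od}$ (convention $0\ln0=0$), subject to (S), (K), the linearization constraints $u_{od,l,s}\le x_{od}^{pt}$, $u_{od,l,s}\le\alpha_{od}z_{ls}$, $u_{od,l,s}\ge x_{od}^{pt}-\alpha_{od}(1-z_{ls})$, $u_{od,l,s}\ge0$ (which enforce $u_{od,l,s}=x_{od}^{pt}z_{ls}$), and $$x_{od}^{pt}\ln(x_{od}^{pt})-x_{od}^{pt}\ln(\alpha_{od}-x_{od}^{pt})+\mathrm{VOT}\sum_{l\in\Gamma_{od}}\sum_{s\in S}\frac{1}{2s}u_{od,l,s}+x_{od}^{pt}(C_{od}+V_{od}^a)\le0\quad\text{for all }(o,d)\in\tilde D.$$ *)

(* Defs.v *)
From HB Require Import structures.
From mathcomp Require Import all_boot all_order all_algebra.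
From mathcomp Require Import finmap.
From mathcomp Require Import all_classical all_reals sequences exp.
Set Implicit Arguments.
Unset Strict Implicit.
Unset Printing Implicit Defensive.
Import Order.TTheory GRing.Theory Num.Theory.
Local Open Scope ring_scope.

(* The 0/1 indicators eta, mu and the binary variables z are booleans, read as
   real numbers through (_)%:R.  The reference paths enter only through lines_of
   (Gamma_od), eta and mu, which are not assumed to be related. *)
Record pt_data (R : realType) := PTData {
  od_pair : finType;
  line : finType;
  edge : finType;
  freqs : {fset R};                        (* S *)
  demand : od_pair -> R;                   (* alpha_od *)
  lines_of : od_pair -> {set line};        (* Gamma_od *)
  eta : edge -> od_pair -> bool;
  mu : edge -> line -> bool;
  capacity : line -> R;                    (* C_l *)
  op_cost : line -> R;                     (* K_l *)
  vot : R;
  fare : R;                                (* P^pt *)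
  benefit : R;                             (* omega *)
  transit_time : od_pair -> R;             (* tau_od^pt *)
  amod_utility : od_pair -> R;             (* V_od^a *)
  freqs_gt0 : forall f, f \in freqs -> 0 < f;
  demand_gt0 : forall od, 0 < demand od;
  capacity_gt0 : forall l, 0 < capacity l;
  vot_gt0 : 0 < vot;
  fare_benefit_gt0 : 0 < fare + benefit
}.

Section PTBestResponse.
Context {R : realType} (N : pt_data R).

Implicit Types (x : od_pair N -> R) (s : line N -> R).
Implicit Types (z : line N -> freqs N -> bool).
Implicit Types (u : od_pair N -> line N -> freqs N -> R).

(* C_od *)
Definition fixed_cost (od : od_pair N) : R :=
  vot N * transit_time od + fare N.

Definition waiting_time s (od : od_pair N) : R :=
  \sum_(l in lines_of od) 1 / (2 * s l).

Definition is_logit_flow s (od : od_pair N) (y : R) : Prop :=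
  [/\ 0 < y, y < demand od &
      ln (y / (demand od - y)) =
      - (vot N * waiting_time s od) - fixed_cost od - amod_utility od].

(* Well defined by [logit_flow_unique] below. *)
Definition logit_flow s : od_pair N -> R :=
  fun od => xget 0 (is_logit_flow s od).

Definition frequency_selection s z : Prop :=
  forall l, \sum_(f : freqs N) (z l f)%:R = 1 :> R /\
            s l = \sum_(f : freqs N) fsval f * (z l f)%:R.

Definition capacity_constraint x s : Prop :=
  forall e, \sum_od (eta e od)%:R * x od <=
            \sum_l capacity l * (mu e l)%:R * s l.

Definition Omega_cap s : set (od_pair N -> R) :=
  [set x | (forall od, 0 <= x od <= demand od) /\ capacity_constraint x s]%classic.

Definition objective x s : R :=
  \sum_od (fare N + benefit N) * x od - \sum_l op_cost l * s l.

Definition original_feasible x s z : Prop :=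
  [/\ frequency_selection s z,
      capacity_constraint x s &
      x = logit_flow s].

Definition original_optimal x s z : Prop :=
  original_feasible x s z /\
  forall x' s' z', original_feasible x' s' z' ->
    objective x' s' <= objective x s.

Definition linearization x z u : Prop :=
  forall od l f,
    [/\ u od l f <= x od,
        u od l f <= demand od * (z l f)%:R,
        x od - demand od * (1 - (z l f)%:R) <= u od l f &
        0 <= u od l f].

(* The convention 0 ln 0 = 0 is automatic, [ln] being total. *)
Definition relaxed_logit x u : Prop :=
  forall od,
    x od * ln (x od) - x od * ln (demand od - x od)
    + vot N * (\sum_(l in lines_of od) \sum_(f : freqs N)
                 1 / (2 * fsval f) * u od l f)
    + x od * (fixed_cost od + amod_utility od) <= 0.

Definition micp_feasible x s z u : Prop :=
  [/\ forall od, 0 <= x od < demand od,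
      frequency_selection s z,
      capacity_constraint x s,
      linearization x z u &
      relaxed_logit x u].

Definition micp_optimal x s z u : Prop :=
  micp_feasible x s z u /\
  forall x' s' z' u', micp_feasible x' s' z' u' ->
    objective x' s' <= objective x s.

Lemma logit_flow_unique s od :
  is_logit_flow s od (logit_flow s od) /\
  forall y, is_logit_flow s od y -> y = logit_flow s od.
Proof.
have a0 := demand_gt0 od.
set c := - (vot N * waiting_time s od) - fixed_cost od - amod_utility od.
have e0 : 0 < expR c := expR_gt0 c.
have e1 : 0 < 1 + expR c by rewrite addr_gt0.
have ex : is_logit_flow s od (demand od * expR c / (1 + expR c)).
  have Ea : demand od - demand od * expR c / (1 + expR c) =
            demand od / (1 + expR c).
    rewrite -[X in X - _](mulfK (lt0r_neq0 e1)) -mulrBl mulrDr mulr1.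
    by rewrite addrK.
  split; first by rewrite divr_gt0// mulr_gt0.
    by rewrite -subr_gt0 Ea divr_gt0.
  rewrite Ea -/c -[RHS]expRK; congr ln.
  rewrite invf_div mulrA mulfVK ?lt0r_neq0//.
  by rewrite mulrAC mulfV ?mul1r// lt0r_neq0.
have uniq y1 y2 : is_logit_flow s od y1 -> is_logit_flow s od y2 -> y1 = y2.
  move=> [y1_gt0 y1_lt E1] [y2_gt0 y2_lt E2].
  have d1 : 0 < demand od - y1 by rewrite subr_gt0.
  have d2 : 0 < demand od - y2 by rewrite subr_gt0.
  have /ln_inj : ln (y1 / (demand od - y1)) = ln (y2 / (demand od - y2)).
    by rewrite E1 E2.
  rewrite !posrE !divr_gt0// => /(_ isT isT) /eqP.
  rewrite eqr_div ?lt0r_neq0// !mulrBr (mulrC y2 y1) => /eqP /addIr.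
  by move=> /(mulIf (lt0r_neq0 a0)).
have Hget : is_logit_flow s od (logit_flow s od).
  exact: (xgetPex 0 (ex_intro (is_logit_flow s od) _ ex)).
by split=> // y /uniq; exact.
Qed.

End PTBestResponse.

(* Main.v *)
Require Import Defs.
From mathcomp Require Import all_boot all_order all_algebra.
From mathcomp Require Import finmap.
From mathcomp Require Import all_classical all_reals sequences exp.
From mathcomp Require Import ring lra.
Import Order.TTheory GRing.Theory Num.Theory.
Local Open Scope ring_scope.

(** The relaxation only replaces the logit equality by an inequality.  Once a
    frequency vector is selected, the linearization forces [u = x * z], the
    transit term becomes [x * vot * W(s)], and the relaxed constraint divided by
    a positive flow [x] says that the log-odds [ln (x / (demand - x))] are at
    most those of the logit flow.  Log-odds are increasing, so the relaxed
    constraint is exactly [x <= logit_flow s] ([relaxed_logitE]): the MICP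
    bounds the flow by the logit flow.

    Hence the original feasible points are MICP feasible
    ([logit_flow_micp_feasible]), and the objective, whose flow coefficient is
    positive, pushes the flow up to that bound ([objective_max_flow]) whenever
    capacity admits the logit flow at [s].  An MICP optimum is then the logit
    flow itself, and optimality over the larger MICP set gives optimality over
    the original one.  Conversely an exact solution is its own logit flow and
    satisfies capacity. *)

Lemma ler_ln_odds {R : realType} (a x y : R) :
  0 < x < a -> 0 < y < a ->
  (ln (x / (a - x)) <= ln (y / (a - y))) = (x <= y).
Proof.
move=> /andP[x0 xa] /andP[y0 ya].
have dx : 0 < a - x by rewrite subr_gt0.
have dy : 0 < a - y by rewrite subr_gt0.
rewrite ler_ln ?posrE ?divr_gt0// ler_pdivrMr// mulrAC ler_pdivlMr//.
have a0 : 0 < a := lt_trans x0 xa.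
by rewrite !mulrBr (mulrC y x) lerD2r ler_pM2r.
Qed.

Section Relaxation.
Context {R : realType} {N : pt_data R}.
Implicit Types (x : od_pair N -> R) (s : line N -> R).
Implicit Types (z : line N -> freqs N -> bool).
Implicit Types (u : od_pair N -> line N -> freqs N -> R).

(** A line runs at exactly one frequency, so any function of the frequency can
    be read off linearly from [z]; this is what makes the nonlinear waiting
    time linear in [z]. *)
Lemma frequency_selection_sum {s z} (l : line N) (g : R -> R) :
  frequency_selection s z ->
  \sum_(f : freqs N) g (fsval f) * (z l f)%:R = g (s l).
Proof.
move=> /(_ l)[z1 sE].
have [f0 zf0] : {f0 | z l =i pred1 f0}.
  by apply: mem_card1; apply/eqP; rewrite -sum1_card -(eqr_nat R) natr_sum
    big_mkcond -z1; apply/eqP/eq_bigr => f _; rewrite unfold_in; case: (z l f).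
have pickE (h : R -> R) :
    \sum_(f : freqs N) h (fsval f) * (z l f)%:R = h (fsval f0).
  have zE f : z l f = (f == f0) := zf0 f.
  rewrite (bigD1 f0)//= zE eqxx mulr1 big1 ?addr0// => f /negbTE ff0.
  by rewrite zE ff0 mulr0.
by rewrite pickE sE (pickE id).
Qed.

Lemma linearization_mulE {x z u} :
  linearization x z u -> forall od l f, u od l f = x od * (z l f)%:R.
Proof.
move=> lin od l f; have [] := lin od l f.
by case: (z l f) => /= *; apply/eqP; rewrite eq_le; apply/andP; split; lra.
Qed.

Lemma linearization_mul x z :
  (forall od, 0 <= x od <= demand od) ->
  linearization x z (fun od l f => x od * (z l f)%:R).
Proof.
by move=> xb od l f; have /andP[] := xb od; case: (z l f) => /= *; split; lra.
Qed.

Lemma linearization_waiting_time {x s z u} (od : od_pair N) :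
  frequency_selection s z -> linearization x z u ->
  \sum_(l in lines_of od) \sum_(f : freqs N) 1 / (2 * fsval f) * u od l f
  = x od * waiting_time s od.
Proof.
move=> sel lin; rewrite /waiting_time mulr_sumr; apply: eq_bigr => l _.
rewrite -(frequency_selection_sum l (fun t => 1 / (2 * t)) sel) mulr_sumr.
by apply: eq_bigr => f _; rewrite (linearization_mulE lin) mulrCA.
Qed.

Lemma logit_flow_bounds s (od : od_pair N) : 0 < logit_flow s od < demand od.
Proof. by have [[-> ->]] := logit_flow_unique s od. Qed.

(** At a positive flow the constraint is [x] times the difference between the
    log-odds of [x] and those of the logit flow; at zero flow both sides hold. *)
Lemma relaxed_logitE {x s z u} :
  (forall od, 0 <= x od < demand od) ->
  frequency_selection s z -> linearization x z u ->
  relaxed_logit x u <-> forall od, x od <= logit_flow s od.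
Proof.
move=> xb sel lin.
suff E od :
    (x od * ln (x od) - x od * ln (demand od - x od)
     + vot N * (\sum_(l in lines_of od) \sum_(f : freqs N)
                  1 / (2 * fsval f) * u od l f)
     + x od * (fixed_cost od + amod_utility od) <= 0)
    = (x od <= logit_flow s od).
  by split=> H od; [rewrite -E; exact: H | rewrite E; exact: H].
rewrite (linearization_waiting_time od sel lin).
have /andP[x0 xa] := xb od; have lb := logit_flow_bounds s od.
have [[_ _ lnL] _] := logit_flow_unique s od.
move: x0; rewrite le_eqVlt => /predU1P[<- | x0].
  by rewrite !mul0r mulr0 subr0 !addr0 lexx; case/andP: lb => /ltW ->.
rewrite -(@ler_ln_odds _ (demand od)) ?x0// lnL.
rewrite ln_div ?posrE ?subr_gt0//.
rewrite -[RHS]subr_le0 -[RHS](pmulr_rle0 _ x0); congr (_ <= 0); ring.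
Qed.

(** The original problem embeds in the MICP: the logit flow attains the bound
    set by the relaxed constraint. *)
Lemma logit_flow_micp_feasible {s z} :
  frequency_selection s z -> capacity_constraint (logit_flow s) s ->
  micp_feasible (logit_flow s) s z
    (fun od l f => logit_flow s od * (z l f)%:R).
Proof.
move=> sel cap.
have b od : 0 <= logit_flow s od < demand od.
  by have /andP[/ltW -> ->] := logit_flow_bounds s od.
have lin : linearization (logit_flow s) z
    (fun od l f => logit_flow s od * (z l f)%:R).
  by apply: linearization_mul => od; have /andP[-> /ltW ->] := b od.
by split=> //; apply/(relaxed_logitE b sel lin).
Qed.

(** The revenue per unit of flow is positive, so raising any single component
    of the flow raises the objective strictly. *)
Lemma objective_max_flow x y s :
  (forall od, x od <= y od) -> objective y s <= objective x s -> x = y.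
Proof.
move=> xy; rewrite /objective lerD2r => le_yx; apply/funext => od0.
have w0 := fare_benefit_gt0 N.
have terms od : (fare N + benefit N) * x od <= (fare N + benefit N) * y od.
  by rewrite ler_pM2l.
apply/eqP; rewrite eq_le xy /= -(ler_pM2l w0).
move: le_yx; rewrite (bigD1 od0) //= [leRHS](bigD1 od0) //= => le_yx.
have rest : \sum_(od | od != od0) (fare N + benefit N) * x od
            <= \sum_(od | od != od0) (fare N + benefit N) * y od.
  by apply: ler_sum => od _; exact: terms.
lra.
Qed.

End Relaxation.

Theorem lemma4p5 (R : realType) (N : pt_data R)
    (x : od_pair N -> R) (s : line N -> R)
    (z : line N -> freqs N -> bool)
    (u : od_pair N -> line N -> freqs N -> R)
    (hopt : micp_optimal x s z u) :
  original_optimal x s z <-> Omega_cap s (logit_flow s).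
Proof.
have [[xb sel cap lin rel] opt] := hopt; split.
  move=> [[_ capx xE] _]; rewrite xE in capx; split=> // od.
  by have /andP[/ltW -> /ltW ->] := logit_flow_bounds s od.
move=> [_ capL].
have xL : x = logit_flow s.
  apply: (@objective_max_flow _ _ _ _ s).
    exact/(relaxed_logitE xb sel lin).
  exact: opt _ _ _ _ (logit_flow_micp_feasible sel capL).
split; first by split.
move=> x' s' z' [sel' cap' x'E]; rewrite x'E in cap' *.
exact: opt _ _ _ _ (logit_flow_micp_feasible sel' cap').
Qed.
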